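(* The dynamical system $\big(B(0,1),\mathcal{B},\mu,T\big)$ is measure-preserving, i.e. $\mu(T^{-1}E)=\mu(E)$ for every $E\in\mathcal{B}$.
   Context: Let $p$ be a prime and let $K$ be a finite extension of $\mathbb{Q}_p$ of degree $m$, with ramification index $e$ and residue degree $f$ (so $m=ef$). Let $|\cdot|$ be the unique extension to $K$ of the $p$-adic absolute value with $|p|=p^{-1}$. Let $L\subseteq K$ be the unramified subextension of degree $f$ over $\mathbb{Q}_p$, write $L=\mathbb{Q}_p(\gamma)$ with $\gamma$ a primitive $(p^f-1)$-th root of unity, and fix $\beta\in K$ with $K=L(\beta)$ and $|\beta|=p^{1/e}$. For $b=\sum_{j\ge n_0}a_jp^j\in\mathbb{Q}_p$ with $a_j\in\{0,1,\dots,p-1\}$ put $\lfloor b\rfloor_p=\sum_{n_0\le j\le 0}a_jp^j$ (which is $0$ if $|b|<1$). Every $\alpha\in K$ is uniquely $\alpha=\sum_{i=0}^{e-1}\sum_{j=0}^{f-1}b_{i,j}\gamma^j\beta^i$ with $b_{i,j}\in\mathbb{Q}_p$, and $\lfloor\alpha\rfloor=\sum_{i=0}^{e-1}\sum_{j=0}^{f-1}\lfloor b_{i,j}\rfloor_p\gamma^j\beta^i$. Let $B(0,1)=\{x\in K:|x|<1\}$, let $\mathcal{B}$ be its Borel $\sigma$-algebra, and let $\mu$ be the restriction to $B(0,1)$ of the Haar measure of the additive group $K$, normalized by $\mu(B(0,1))=1$. The continued fraction map $T:B(0,1)\to B(0,1)$ is $T(\alpha)=\frac1\alpha-\left\lfloor\frac1\alpha\right\rfloor$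 for $\alpha\ne 0$ and $T(0)=0$. *)

(* Defs.v *)
From HB Require Import structures.
From mathcomp Require Import all_boot all_order all_algebra all_field.
From mathcomp Require Import all_classical all_reals all_analysis.

Set Implicit Arguments.
Unset Strict Implicit.
Unset Printing Implicit Defensive.

Import Order.TTheory GRing.Theory Num.Theory.
Import numFieldNormedType.Exports.

Local Open Scope classical_set_scope.
Local Open Scope ring_scope.

Definition absolute_value (R : realType) (F : fieldType) (v : F -> R) : Prop :=
  [/\ forall x, 0 <= v x,
      forall x, v x = 0 <-> x = 0,
      forall x y, v (x * y) = v x * v y
    & forall x y, v (x + y) <= v x + v y].

(* |q|_p on the rationals, normalized by |p|_p = 1/p *)
Definition padic_abs (R : realType) (p : nat) (q : rat) : R :=
  if q == 0 then 0
  else p%:R ^+ logn p `|denq q|%N / p%:R ^+ logn p `|numq q|%N.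

(* (Qp, v) is a completion of (rat, |.|_p). This determines (Qp, v) up to a
   unique isometric isomorphism, so "for all (Qp, v) that are a p-adic
   completion" means "for the field of p-adic numbers". The first two clauses
   force characteristic 0 (v n%:R != 0 for 0 < n), so ratr is an embedding. *)
Definition padic_completion (R : realType) (p : nat) (Qp : fieldType)
    (v : Qp -> R) : Prop :=
  [/\ absolute_value v,
      forall q : rat, v (ratr q) = padic_abs R p q,
      forall (x : Qp) (eps : R), 0 < eps -> exists q : rat, v (x - ratr q) < eps
    & forall u : nat -> Qp,
        (forall eps : R, 0 < eps -> exists N : nat, forall m n : nat,
           (N <= m)%N -> (N <= n)%N -> v (u m - u n) < eps) ->
        exists l : Qp, (fun n => v (u n - l)) @ \oo --> (0 : R)].

(* b = \sum_(j >= - n) a_j p^j with digits a_j = a (n + j); every starting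
   index n0 is covered, since leading digits may be 0. *)
Definition padic_expansion (R : realType) (p : nat) (Qp : fieldType)
    (v : Qp -> R) (b : Qp) (n : nat) (a : nat -> nat) : Prop :=
  (forall k, (a k < p)%N) /\
  (fun N => v (b - \sum_(k < N) (a k)%:R * p%:R ^ (k%:Z - n%:Z))) @ \oo
    --> (0 : R).

(* The part \sum_(- n <= j <= 0) a_j p^j of the expansion of b. The expansion
   exists, and the sum does not depend on n, so the default 0 is never used. *)
Definition padic_floor (R : realType) (p : nat) (Qp : fieldType)
    (v : Qp -> R) (b : Qp) : Qp :=
  xget 0 [set c | exists n a, padic_expansion p v b n a /\
                  c = \sum_(k < n.+1) (a k)%:R * p%:R ^ (k%:Z - n%:Z)].

Section Extension.
Variables (R : realType) (Qp : fieldType) (K : fieldExtType Qp) (v : K -> R).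

(* The index of the value group of Qp in the value group of L is e: the
   v (r i) form a transversal of the cosets. *)
Definition ramification_index (L : {vspace K}) (e : nat) : Prop :=
  exists2 r : 'I_e -> K,
    forall i, r i \in L /\ r i != 0
  & forall x, x \in L -> x != 0 ->
      exists! i : 'I_e, exists2 a : Qp, a != 0 & v x = v (a *: r i).

(* The residue field of K has dimension f over that of Qp: the classes of the
   integers u i modulo the maximal ideal {v < 1} are a basis. *)
Definition residue_degree (f : nat) : Prop :=
  exists u : 'I_f -> K,
  [/\ forall i, v (u i) <= 1,
      forall x, v x <= 1 -> exists2 c : 'I_f -> Qp,
        forall i, v (c i)%:A <= 1 & v (x - \sum_i c i *: u i) < 1
    & forall c : 'I_f -> Qp, (forall i, v (c i)%:A <= 1) ->
        v (\sum_i c i *: u i) < 1 -> forall i, v (c i)%:A < 1].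

(* Residue field extensions are separable here, the residue field of Qp being
   finite, so being unramified only constrains the value group. *)
Definition unramified (L : {vspace K}) : Prop := ramification_index L 1.

Definition unit_ball : set K := [set x | v x < 1].

Section ContinuedFraction.
Variables (p : nat) (vQ : Qp -> R) (e f : nat) (gamma beta : K).

Definition from_coords (b : 'M[Qp]_(e, f)) : K :=
  \sum_(i < e) \sum_(j < f) b i j *: (gamma ^+ j * beta ^+ i).

(* In the intended situation the gamma^j beta^i are a basis of K over Qp, and
   this is the inverse of from_coords. *)
Definition coords (x : K) : 'M[Qp]_(e, f) := xget 0 [set b | x = from_coords b].

Definition cf_floor (x : K) : K :=
  from_coords (\matrix_(i, j) padic_floor p vQ (coords x i j)).

Definition cf_map (x : K) : K :=
  if x == 0 then 0 else x^-1 - cf_floor x^-1.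

End ContinuedFraction.
End Extension.

(* K with the topology of the metric v (y - x). *)
Definition valued (R : realType) (K : fieldType) (v : K -> R) : Type := K.

Section Valued.
Variables (R : realType) (K : fieldType) (v : K -> R).

HB.instance Definition _ := Choice.copy (valued v) K.
HB.instance Definition _ := isPointed.Build (valued v) (0 : K).

Definition valued_open (U : set (valued v)) : Prop :=
  forall x : K, U x -> exists2 eps : R, 0 < eps &
    forall y : K, v (y - x) < eps -> U y.

Lemma valued_openT : valued_open setT.
Proof. by move=> x _; exists 1. Qed.

Lemma valued_openI : setI_closed valued_open.
Proof.
move=> A B oA oB x [/oA[r r0 rA] /oB[s s0 sB]].
exists (Order.min r s); first by rewrite lt_min r0.
by move=> y; rewrite lt_min => /andP[/rA ? /sB ?].
Qed.

Lemma valued_open_bigU (I : Type) (F : I -> set (valued v)) :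
  (forall i, valued_open (F i)) -> valued_open (\bigcup_i F i).
Proof.
move=> oF x [i _ /oF[r r0 rF]]; exists r => // y /rF Fy; by exists i.
Qed.

HB.instance Definition _ := isOpenTopological.Build (valued v)
  valued_openT valued_openI valued_open_bigU.

End Valued.

Definition borel (T : ptopologicalType) := g_sigma_algebraType (@open T).

(* Regularity is automatic, K being locally compact and second countable. *)
Definition haar_measure (R : realType) (K : fieldType) (v : K -> R)
    (mu : {measure set (borel (valued v)) -> \bar R}) : Prop :=
  [/\ forall (a : K) (E : set (borel (valued v))), measurable E ->
        mu [set (a + x : K) | x in (E : set K)] = mu E,
      forall C : set (valued v), compact C -> (mu C < +oo)%E
    & mu setT != 0%E].

(* The system (D, Borel subsets of D, mu restricted to D, T), T : D -> D. *)
Definition measure_preserving (R : realType) (d : measure_display)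
    (X : measurableType d) (D : set X) (mu : {measure set X -> \bar R})
    (T : X -> X) : Prop :=
  [/\ forall x, D x -> D (T x),
      measurable_fun D T
    & forall E, measurable E -> E `<=` D -> mu (D `&` T @^-1` E) = mu E].

(* Main.v *)
(* For c in the range of the floor function with |c| > 1, the points with first
   partial quotient c that T maps into the ball of radius r about y are the
   inverses of the points of the ball of radius r about c + y. Since
   |c + y| = |c|, they form a ball of radius r / |c|^2. By translation invariance
   and summation over the countably many c, the measure of the preimage under T
   of a ball contained in B(0,1) depends only on the radius. As every ball is the
   disjoint union of p^f balls of the next smaller radius and
   T^-1(B(0,1)) = B(0,1), both mu and its image under T give the ball
   {x : |x - y| < |beta|^-k} the mass p^(-f k). Balls and the empty set form a
   pi-system generating the Borel sets, so the two measures coincide.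

   The arithmetic input is that the sums of c_j gamma^j with digits c_j < p
   represent the residue field, and that
   |sum of b_ij gamma^j beta^i| = max |b_ij| |beta|^i; hence the floor of x is
   the only floor value at distance less than 1 from x. *)
Require Import Defs.
From mathcomp Require Import all_boot all_order all_algebra all_field.
From mathcomp Require Import all_classical all_reals all_analysis.
From mathcomp Require Import ring lra zify.
Set Implicit Arguments.
Unset Strict Implicit.
Unset Printing Implicit Defensive.
Import Order.TTheory GRing.Theory Num.Theory.
Import numFieldNormedType.Exports.
Local Open Scope classical_set_scope.
Local Open Scope ring_scope.

(** * Absolute values on a field *)

Section AbsoluteValue.
Variables (R : realType) (F : fieldType) (v : F -> R).
Hypothesis av : absolute_value v.

Lemma absv_ge0 x : 0 <= v x.
Proof. by case: av. Qed.

Lemma absv0 : v 0 = 0.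
Proof. by case: av => _ /(_ 0)[_ ->]. Qed.

Lemma absv_eq0 x : (v x == 0) = (x == 0).
Proof. by case: av => _ /(_ x) h _ _; apply/eqP/eqP => /h. Qed.

Lemma absv_gt0 x : (0 < v x) = (x != 0).
Proof. by rewrite lt_def absv_eq0 absv_ge0 andbT. Qed.

Lemma absvM x y : v (x * y) = v x * v y.
Proof. by case: av. Qed.

Lemma absv1 : v 1 = 1.
Proof.
have v10 : v 1 != 0 by rewrite absv_eq0 oner_eq0.
by apply: (mulfI v10); rewrite -absvM !mulr1.
Qed.

Lemma absvX x n : v (x ^+ n) = v x ^+ n.
Proof. by elim: n => [|n IH]; rewrite ?expr0 ?absv1// !exprS absvM IH. Qed.

Lemma absvV x : v x^-1 = (v x)^-1.
Proof.
have [->|x0] := eqVneq x 0; first by rewrite invr0 absv0 invr0.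
have vx0 : v x != 0 by rewrite absv_eq0.
by apply: (mulfI vx0); rewrite -absvM !divff // absv1.
Qed.

Lemma absvN x : v (- x) = v x.
Proof.
rewrite -mulN1r absvM; suff -> : v (-1) = 1 by rewrite mul1r.
apply/eqP; rewrite -(eqrXn2 (_ : 0 < 2)%N) ?absv_ge0 ?ler01//.
by rewrite -absvX sqrrN !expr1n absv1.
Qed.

Lemma absvB x y : v (x - y) = v (y - x).
Proof. by rewrite -absvN opprB. Qed.

Lemma absvZ x (k : int) : v (x ^ k) = v x ^ k.
Proof. by case: k => n; rewrite ?NegzE -?exprnP -?exprnN ?absvV absvX. Qed.

Lemma bernoulli_le (h : R) n : 0 <= h -> 1 + n%:R * h <= (1 + h) ^+ n.
Proof.
move=> h0; elim: n => [|n IH]; first by rewrite mul0r addr0.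
rewrite exprS; apply: (le_trans _ (ler_wpM2l _ IH)); last by lra.
have : 0 <= n%:R * h * h by rewrite !mulr_ge0.
by rewrite -(natr1 n); lra.
Qed.

(** With [r = 1 + h] and [h > 0], Bernoulli bounds [r ^+ (n * 2)] below by [(1 + n h)^2], which is
    quadratic in [n] and outgrows [2 n + 1]. *)
Lemma expr_le_linear_le1 (r : R) :
  0 <= r -> (forall n, r ^+ n <= n.+1%:R) -> r <= 1.
Proof.
move=> r0 H; rewrite leNgt; apply/negP => r1.
pose h := r - 1; have h0 : 0 < h by rewrite subr_gt0.
(* The constant 3 suffices because [2 n + 1 <= 3 n < n^2 h^2] once [n >= 1]. *)
have [n hn] : exists n : nat, 3 < n.+1%:R * h ^+ 2.
  exists (Num.truncn (3 / h ^+ 2)).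
  by rewrite -ltr_pdivrMr ?exprn_gt0// truncnS_gt.
move: n.+1 (ltn0Sn n) hn => {}n n0 hn.
have b : 1 + n%:R * h <= r ^+ n.
  by rewrite -(subrKC 1 r) bernoulli_le// ltW.
have b2 : (1 + n%:R * h) ^+ 2 <= (n * 2).+1%:R.
  apply: le_trans (H (n * 2)%N); rewrite exprM lerXn2r// nnegrE.
  - by rewrite addr_ge0// mulr_ge0// ltW.
  - by rewrite exprn_ge0.
move: b2; apply/negP; rewrite -ltNge.
have n1 : 1 <= n%:R :> R by rewrite ler1n.
have : n%:R * 3 < n%:R * (n%:R * h ^+ 2) by rewrite ltr_pM2l// (lt_le_trans _ n1).
rewrite -(natr1 (n * 2)) natrM.
have : 0 <= n%:R * h by rewrite mulr_ge0// ltW.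
nra.
Qed.

Lemma absv_sum_le (I : Type) (s : seq I) (P : pred I) (G : I -> F) :
  v (\sum_(i <- s | P i) G i) <= \sum_(i <- s | P i) v (G i).
Proof.
apply: (big_ind2 (fun x y => v x <= y)) => // [|x y z t xy zt].
  by rewrite absv0.
case: av => _ _ _ D; apply: le_trans (D _ _) _; exact: lerD.
Qed.

(* Expand (x + y)^n binomially: the n + 1 terms are each bounded by M^n, and the
   factor n + 1 disappears in the limit of n-th roots. *)
Lemma ultrametric_of_bounded_nat (M : R) x y :
  (forall n, v n%:R <= 1) -> v x <= M -> v y <= M -> v (x + y) <= M.
Proof.
move=> vn xM yM; have M0 : 0 <= M by exact: le_trans (absv_ge0 x) xM.
have [Mz|Mp] := eqVneq M 0.
  move: xM yM; rewrite Mz => xM yM.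
  have /eqP : v x = 0 by apply/le_anti; rewrite xM absv_ge0.
  have /eqP : v y = 0 by apply/le_anti; rewrite yM absv_ge0.
  by rewrite !absv_eq0 => /eqP-> /eqP->; rewrite addr0 absv0.
have {Mp}M1 : 0 < M by rewrite lt_def Mp.
rewrite -[leRHS]mul1r -ler_pdivrMr//.
apply: expr_le_linear_le1 => [|n]; first by rewrite divr_ge0// absv_ge0.
rewrite expr_div_n ler_pdivrMr ?exprn_gt0// -absvX exprDn.
apply: le_trans (absv_sum_le _ _ _) _.
apply: (@le_trans _ _ (\sum_(i < n.+1) M ^+ n)); last first.
  by rewrite sumr_const card_ord mulr_natl.
apply: ler_sum => i _.
rewrite -mulr_natl !absvM -[leRHS]mul1r ler_pM ?mulr_ge0 ?absv_ge0//.
rewrite !absvX -[in leRHS](subnK (leq_ord i)) exprD.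
by rewrite ler_pM ?exprn_ge0 ?absv_ge0// lerXn2r ?nnegrE ?absv_ge0.
Qed.

End AbsoluteValue.

(** * Ultrametric inequalities *)

Section Ultrametric.
Variables (R : realType) (F : fieldType) (v : F -> R).
Hypothesis av : absolute_value v.
Hypothesis vn : forall n, v n%:R <= 1.

Lemma ultraD M x y : v x <= M -> v y <= M -> v (x + y) <= M.
Proof. exact: ultrametric_of_bounded_nat. Qed.

Lemma ultraB M x y : v x <= M -> v y <= M -> v (x - y) <= M.
Proof. by move=> xM yM; apply: ultraD; rewrite ?absvN. Qed.

Lemma ultraD_lt M x y : v x < M -> v y < M -> v (x + y) < M.
Proof.
move=> xM yM; apply: (@le_lt_trans _ _ (Num.max (v x) (v y))).
  by apply: ultraD; rewrite le_max lexx ?orbT.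
by rewrite gt_max xM.
Qed.

Lemma ultraB_lt M x y : v x < M -> v y < M -> v (x - y) < M.
Proof. by move=> xM yM; apply: ultraD_lt; rewrite ?absvN. Qed.

Lemma ultra_trans_lt M x y z : v (x - y) < M -> v (y - z) < M -> v (x - z) < M.
Proof. by move=> xy yz; rewrite -(subrKA y) ultraD_lt. Qed.

Lemma ultra_trans M x y z : v (x - y) <= M -> v (y - z) <= M -> v (x - z) <= M.
Proof. by move=> xy yz; rewrite -(subrKA y) ultraD. Qed.

(** Triangles are isosceles: if [v y] were below [v x], then [x], the sum of [x - y] and [y], would
    have value less than its own. *)
Lemma ultra_eq x y : v (x - y) < v x -> v y = v x.
Proof.
move=> xy; apply/le_anti/andP; split.
  by rewrite -(subKr x y) ultraB// ltW.
rewrite leNgt; apply/negP => yx.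
by have := ultraD_lt xy yx; rewrite subrK ltxx.
Qed.

Lemma ultra_sum (I : Type) (s : seq I) (P : pred I) (G : I -> F) M :
  0 <= M -> (forall i, P i -> v (G i) <= M) ->
  v (\sum_(i <- s | P i) G i) <= M.
Proof.
move=> M0 H; elim/big_ind: _ => //; first by rewrite absv0.
by move=> x y; exact: ultraD.
Qed.

Lemma ultra_sum_lt (I : Type) (s : seq I) (P : pred I) (G : I -> F) M :
  0 < M -> (forall i, P i -> v (G i) < M) ->
  v (\sum_(i <- s | P i) G i) < M.
Proof.
move=> M0 H; elim/big_ind: _ => //; first by rewrite absv0.
by move=> x y; exact: ultraD_lt.
Qed.

End Ultrametric.

(** * Values, residues and floors of p-adic numbers *)

Section Padic.
Variables (R : realType) (p : nat) (Qp : fieldType) (vQ : Qp -> R).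
Hypotheses (p_prime : prime p) (compl : padic_completion p vQ).

Lemma padic_absv : absolute_value vQ.
Proof. by case: compl. Qed.
Let avQ := padic_absv.

Let pR_gt1 : 1 < p%:R :> R.
Proof. by rewrite ltr1n prime_gt1. Qed.

Let pR_gt0 : 0 < p%:R :> R.
Proof. by rewrite ltr0n prime_gt0. Qed.

Lemma padic_nat n : (0 < n)%N -> vQ n%:R = p%:R ^- logn p n.
Proof.
move=> n0; case: compl => _ /(_ n%:R) + _ _; rewrite ratr_nat => ->.
rewrite /padic_abs pnatr_eq0 eqn0Ngt n0 /= (pmulrn (1 : rat)) numq_int denq_int /=.
by rewrite logn1 expr0 mul1r.
Qed.

Lemma padic_nat_le1 n : vQ n%:R <= 1.
Proof.
case: n => [|n]; first by rewrite absv0.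
by rewrite padic_nat// invf_le1 ?exprn_gt0// exprn_ege1// ltW.
Qed.
Let vn := padic_nat_le1.

Lemma padic_int_le1 (z : int) : vQ z%:~R <= 1.
Proof. by case: z => n; rewrite ?NegzE ?mulrNz ?absvN// -pmulrn. Qed.

Lemma padic_p : vQ p%:R = p%:R^-1.
Proof. by rewrite padic_nat ?prime_gt0// logn_prime// eqxx. Qed.

Lemma padic_p_lt1 : vQ p%:R < 1.
Proof. by rewrite padic_p invf_lt1. Qed.

(** The exact power of [p] dividing [n] is at most [n], so its exponent is at most [N]. *)
Lemma padic_nat_ge N n : (0 < n)%N -> (n < p ^ N.+1)%N -> p%:R ^- N <= vQ n%:R.
Proof.
move=> n0 nN; rewrite padic_nat// lef_pV2 ?posrE ?exprn_gt0//.
rewrite ler_eXn2l// -ltnS -(ltn_exp2l _ _ (prime_gt1 p_prime)).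
by apply: leq_ltn_trans nN; rewrite dvdn_leq// pfactor_dvdnn.
Qed.

Lemma padic_natB_eq N m n : (m < p ^ N.+1)%N -> (n < p ^ N.+1)%N ->
  vQ (m%:R - n%:R) < p%:R ^- N -> m = n.
Proof.
wlog mn : m n / (m <= n)%N => [W mN nN H|mN nN].
  case/orP: (leq_total m n) => mn; first exact: W.
  by apply/esym/W; rewrite // absvB.
rewrite absvB// -natrB//; case: (posnP (n - m)%N) => [|nm0].
  by move/eqP; rewrite subn_eq0 => nm _; apply/eqP; rewrite eqn_leq mn.
rewrite ltNge padic_nat_ge//; exact: leq_ltn_trans (leq_subr _ _) nN.
Qed.

Lemma padic_coprime n : coprime p n -> vQ n%:R = 1.
Proof.
case: n => [|n]; first by rewrite /coprime gcdn0 => /eqP p1; move: p_prime; rewrite p1.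
rewrite prime_coprime// => pn; rewrite padic_nat//.
by rewrite (lognE p) p_prime /= (negbTE pn) expr0 invr1.
Qed.

(** With an error below [vQ x], [ultra_eq] gives [q] the value of [x]; thus facts about values pass
    from the rationals to [Qp]. *)
Lemma padic_dense (x : Qp) : x != 0 -> exists2 q : rat, q != 0 &
  vQ (x - ratr q) < vQ x.
Proof.
move=> x0; case: compl => _ _ /(_ x (vQ x)) + _; rewrite absv_gt0// => /(_ x0).
move=> [q Hq]; exists q => //; apply: contraTneq Hq => ->.
by rewrite (ratr_nat _ 0) subr0 ltxx.
Qed.

Lemma padic_value (x : Qp) : x != 0 -> exists k : int, vQ x = p%:R ^ k.
Proof.
move=> /padic_dense[q q0 /(ultra_eq avQ vn) <-].
case: compl => _ -> _ _; rewrite /padic_abs (negbTE q0).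
set a := logn _ _; set b := logn _ _; exists (a%:Z - b%:Z).
by rewrite expfzDr ?gt_eqF// exprnN.
Qed.

(** A rational [q] close to [b] has denominator [d] prime to [p]; with [u] a Bezout inverse of [d]
    modulo [p], the digit is [numq q * u] reduced modulo [p]. *)
Lemma padic_residue (b : Qp) : vQ b <= 1 ->
  exists2 a : nat, (a < p)%N & vQ (b - a%:R) < 1.
Proof.
move=> b1; have [->|b0] := eqVneq b 0.
  by exists 0%N; rewrite ?prime_gt0// subr0 absv0// ltr01.
have [q q0 Hq] := padic_dense b0.
have vq : vQ (ratr q) <= 1 by rewrite (ultra_eq avQ vn Hq).
pose d := `|denq q|%N; have d0 : (0 < d)%N by rewrite absz_gt0 denq_neq0.
have pd : coprime p d.
  rewrite prime_coprime//; apply/negP => pd; move: vq; apply/negP; rewrite -ltNge.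
  case: compl => _ -> _ _; rewrite /padic_abs (negbTE q0).
  rewrite (lognE _ `|numq q|%N) p_prime /=.
  have -> : (p %| `|numq q|)%N = false.
    apply/negP => pq; have := dvdn_gcd p `|numq q| `|denq q|.
    by rewrite (eqP (coprime_num_den q)) pq pd dvdn1 gtn_eqF// prime_gt1.
  by rewrite andbF expr0 divr1 exprn_egt1// -lt0n logn_gt0 mem_primes p_prime d0.
have [u /dvdzP[w Hw]] : exists u, (p%:Z %| u * d%:Z - 1)%Z.
  have [u [w Huw]] := Bezoutz p%:Z d%:Z.
  have g1 : gcdz p%:Z d%:Z = 1 by rewrite /gcdz !absz_nat; move/eqP: pd => ->.
  exists w; rewrite -g1 -Huw opprD.
  by rewrite addrCA subrr addr0 rpredN dvdz_mull.
pose a := ((numq q * u) %% p%:Z)%Z.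
have p0 : p%:Z != 0 by rewrite -lt0n prime_gt0.
have a0 : 0 <= a by rewrite modz_ge0.
exists `|a|%N; first by rewrite -ltz_nat gez0_abs// ltz_pmod// ltz_nat prime_gt0.
apply: (ultra_trans_lt avQ vn (lt_le_trans Hq b1)).
have vd : vQ d%:R = 1 by exact: padic_coprime.
have d1 : d%:R != 0 :> Qp by rewrite -(absv_eq0 avQ) vd oner_eq0.
have dE : (denq q)%:~R = d%:R :> Qp by rewrite /d pmulrn gez0_abs// denq_ge0.
(* Multiplying by [d], which has value 1, clears the denominator and leaves a divisibility between
   integers. *)
rewrite -[ltLHS]mulr1 -[X in _ * X < _]vd -absvM// mulrBl /ratr dE divfK//.
rewrite pmulrn gez0_abs// (pmulrn _ d) -intrM -intrB.
suff /dvdzP[t ->] : (p%:Z %| numq q - a * d%:Z)%Z.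
  rewrite intrM absvM// -pmulrn; apply: le_lt_trans (ler_piMl _ _) padic_p_lt1.
    exact: absv_ge0.
  exact: padic_int_le1.
have -> : a = numq q * u - (numq q * u %/ p%:Z)%Z * p%:Z.
  by rewrite {1}(divz_eq (numq q * u) p%:Z) addrC addKr.
rewrite mulrBl -mulrA -[u * _](subrK 1) Hw.
apply/dvdzP; exists (- numq q * w + (numq q * u %/ p%:Z)%Z * d%:Z); ring.
Qed.

(** The possible values of the p-adic floor: the base-p digits of [s] occupy the positions from [-n]
    to 0. *)
Definition floor_value (c : Qp) : Prop :=
  exists n s : nat, (s < p ^ n.+1)%N /\ c = s%:R / p%:R ^+ n.

Let pQ0 : p%:R != 0 :> Qp.
Proof. by rewrite -(absv_gt0 avQ) padic_p invr_gt0. Qed.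

(** Over the common denominator [p^(n + n')] both numerators lie below [p^(n + n' + 1)], where
    [padic_natB_eq] separates naturals. *)
Lemma floor_value_eq c c' :
  floor_value c -> floor_value c' -> vQ (c - c') < 1 -> c = c'.
Proof.
move=> [n [s [sn ->]]] [n' [s' [sn' ->]]] H; apply/eqP; rewrite -subr_eq0; move: H.
have pn k : p%:R ^+ k != 0 :> Qp by rewrite expf_neq0.
have -> : s%:R / p%:R ^+ n - s'%:R / p%:R ^+ n' =
    ((s * p ^ n')%N%:R - (s' * p ^ n)%N%:R) / p%:R ^+ (n + n') :> Qp.
  by rewrite !natrM !natrX exprD; field; rewrite !pn.
rewrite absvM// absvV// absvX// padic_p exprVn invrK => H.
rewrite (_ : s * p ^ n' = s' * p ^ n)%N ?subrr ?mul0r//.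
apply: (@padic_natB_eq (n + n')).
- by rewrite -addSn expnD ltn_pmul2r// expn_gt0 prime_gt0.
- by rewrite addnC -addSn expnD ltn_pmul2r// expn_gt0 prime_gt0.
- by rewrite -ltr_pdivlMr ?exprn_gt0// div1r in H.
Qed.

Lemma padic_scale (b : Qp) : exists n, vQ (b * p%:R ^+ n) <= 1.
Proof.
have [->|b0] := eqVneq b 0; first by exists 0%N; rewrite mul0r absv0.
have [[k|k] Hk] := padic_value b0.
  exists k; rewrite absvM// absvX// padic_p Hk exprVn divff//.
  by rewrite expf_neq0// gt_eqF.
exists 0%N; rewrite expr0 mulr1 Hk NegzE -exprnN invf_le1 ?exprn_gt0//.
by rewrite exprn_ege1// ltW.
Qed.

(** The digits come from iterating [st] on [b p^n]: after [N] digits the remainder is an integral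
    [x N] times [p^(N - n)], which tends to 0. *)
Lemma padic_expansion_exists (b : Qp) : exists n a, padic_expansion p vQ b n a.
Proof.
have [n bn] := padic_scale b; exists n.
(* Off the integers the digit is 0 by default; the orbit [x k] never leaves the integers. *)
have /choice[dg Hdg] (x : Qp) : exists a : nat, vQ x <= 1 ->
    (a < p)%N /\ vQ (x - a%:R) < 1.
  have [/padic_residue[a]|] := boolP (vQ x <= 1); first by exists a.
  by exists 0%N.
pose st x := (x - (dg x)%:R) / p%:R.
pose x k := iter k st (b * p%:R ^+ n).
have x1 k : vQ (x k) <= 1.
  elim: k => //= k /Hdg[_ H]; rewrite /st absvM// absvV// padic_p invrK.
  have [->|z0] := eqVneq (x k - (dg (x k))%:R) 0; first by rewrite absv0// mul0r.
  (* Values are integral powers of [p], so a value below 1 is at most [1/p] and dividing by [p]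
     keeps it integral. *)
  move: H; have [m ->] := padic_value z0 => H.
  rewrite -[X in _ * X]expr1z -expfzDr ?gt_eqF//.
  have : m < 0 by move: H; rewrite -(expr0z (p%:R : R)) ltr_eXz2l.
  rewrite -(expr0z (p%:R : R)) ler_eXz2l// addrC -ltzD1 addrC ltrD2r.
  done.
exists (fun k => dg (x k)); split=> [k|]; first by case: (Hdg _ (x1 k)).
have E N : b - \sum_(k < N) (dg (x k))%:R * p%:R ^ (k%:Z - n%:Z) =
    x N * p%:R ^ (N%:Z - n%:Z).
  elim: N => [|N IH].
    by rewrite big_ord0 subr0 /x /= -mulrA (exprnP _ n) -expfzDr// addrC subrK mulr1.
  rewrite big_ord_recr /= opprD addrA IH -mulrBl /st -mulrA; congr (_ * _).
  rewrite -[(p%:R)^-1]exprN1 -expfzDr//; congr (_ ^ _).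
  by rewrite intS; ring.
under eq_fun do rewrite E.
apply: (@squeeze_cvgr _ _ _ _ (fun=> 0) (fun N => p%:R ^+ n * p%:R^-1 ^+ N)).
- near=> N; rewrite absv_ge0//= absvM// absvZ// padic_p.
  rewrite exprz_inv opprB expfzDr ?gt_eqF// -invr_expz exprVn.
  by rewrite ler_piMl// mulr_ge0// ?invr_ge0 exprn_ge0// ltW.
- exact: cvg_cst.
- rewrite -[X in _ --> X](mulr0 (p%:R ^+ n : R)).
  apply: cvgM; first exact: cvg_cst.
  by apply: cvg_expr; rewrite ger0_norm ?invr_ge0 ?ltW// invf_lt1.
Unshelve. all: by end_near.
Qed.

Lemma padic_expansion_floor (b : Qp) n a : padic_expansion p vQ b n a ->
  let c := \sum_(k < n.+1) (a k)%:R * p%:R ^ (k%:Z - n%:Z) in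
  floor_value c /\ vQ (b - c) < 1.
Proof.
move=> [a_lt a_cvg] c; split.
  exists n, (\sum_(k < n.+1) a k * p ^ k)%N; split.
    elim: n.+1 {c} => [|N IH]; first by rewrite big_ord0.
    rewrite big_ord_recr /= expnS; have := a_lt N.
    move: (p ^ N)%N (\sum_(_ < _) _)%N IH => P S SP aP.
    apply: (@leq_trans (P + a N * P)); first by rewrite ltn_add2r.
    by rewrite -mulSn leq_mul2r aP orbT.
  rewrite /c natr_sum big_distrl /=; apply: eq_bigr => k _.
  by rewrite natrM natrX -mulrA expfzDr// exprnN.
(* Some partial sum of at least [n + 1] terms is within 1 of [b]; its terms past index [n] carry
   positive powers of [p]. *)
have /cvgrPdist_lt/(_ 1 ltr01)[N _ HN] := a_cvg.
have := HN (N + n.+1)%N (leq_addr _ _); rewrite /= sub0r normrN ger0_norm ?absv_ge0// => Hb.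
apply: (ultra_trans_lt avQ vn Hb); rewrite addnC big_split_ord /= addrAC subrr add0r.
apply: ultra_sum_lt => // k _.
rewrite absvM//; apply: (le_lt_trans (ler_piMl _ _)); rewrite ?absv_ge0//.
rewrite absvZ// padic_p exprz_inv opprB -[ltRHS](expr0z (p%:R : R)).
by rewrite ltr_eXz2l// subr_lt0 ltz_nat addSn ltnS leq_addr.
Qed.

Lemma padic_floorP (b : Qp) :
  floor_value (padic_floor p vQ b) /\ vQ (b - padic_floor p vQ b) < 1.
Proof.
have [n [a H]] := padic_expansion_exists b.
rewrite /padic_floor; case: xgetP => [c -> [m [a' [/padic_expansion_floor H' ->]]]|].
  exact: H'.
by move=> /(_ (\sum_(k < n.+1) (a k)%:R * p%:R ^ (k%:Z - n%:Z))) []; exists n, a.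
Qed.

End Padic.

(** * The value group of K *)

Section Structure.
Variables (R : realType) (p : nat) (Qp : fieldType) (vQ : Qp -> R)
  (K : fieldExtType Qp) (v : K -> R) (e f : nat) (gamma beta : K).
Hypotheses (p_prime : prime p) (compl : padic_completion p vQ)
  (av : absolute_value v) (extQ : forall a : Qp, v a%:A = vQ a)
  (ram : ramification_index v fullv e) (res : residue_degree v f)
  (prim : (p ^ f - 1).-primitive_root gamma)
  (vbeta : v beta = p%:R `^ (e%:R^-1)).

Let avQ := padic_absv compl.
Let vnQ := padic_nat_le1 p_prime compl.

Lemma ext_nat n : v n%:R = vQ n%:R.
Proof. by rewrite -extQ scaler_nat. Qed.

Lemma ext_nat_le1 n : v n%:R <= 1.
Proof. by rewrite ext_nat. Qed.
Let vn := ext_nat_le1.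

Lemma absv_scale a x : v (a *: x) = vQ a * v x.
Proof. by rewrite -mulr_algl absvM// extQ. Qed.

Let pR_gt1 : 1 < p%:R :> R.
Proof. by rewrite ltr1n prime_gt1. Qed.

Let pR_gt0 : 0 < p%:R :> R.
Proof. by rewrite ltr0n prime_gt0. Qed.

Lemma ramification_gt0 : (0 < e)%N.
Proof.
case: ram => r _ /(_ 1 (memvf _) (oner_neq0 _)) [i _].
exact: leq_ltn_trans (leq0n _) (ltn_ord i).
Qed.

Lemma absv_betaX : v beta ^+ e = p%:R.
Proof.
rewrite vbeta -powR_mulrn ?powR_ge0// -powRrM mulVf ?powRr1 ?ltW//.
by rewrite pnatr_eq0 -lt0n ramification_gt0.
Qed.

Lemma absv_beta_gt1 : 1 < v beta.
Proof.
rewrite ltNge; apply/negP => b1.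
by have := exprn_ile1 e (absv_ge0 av beta) b1; rewrite absv_betaX leNgt pR_gt1.
Qed.

Lemma beta_neq0 : beta != 0.
Proof. by rewrite -(absv_gt0 av) (lt_trans ltr01) ?absv_beta_gt1. Qed.

Lemma absv_beta_gt0 : 0 < v beta.
Proof. by rewrite absv_gt0// beta_neq0. Qed.

Lemma padic_value_beta (a : Qp) : a != 0 -> exists k : int, vQ a = v beta ^ (e%:Z * k).
Proof.
by move=> /(padic_value p_prime compl)[k ->]; exists k;
   rewrite -absv_betaX (exprnP _ e) exprz_exp.
Qed.

(** Nonzero values of [Qp] are powers of [v beta] with exponent divisible by [e], so the exponents
    can be compared modulo [e]. *)
Lemma absv_beta_inj (a b : Qp) (i j : 'I_e) : a != 0 -> b != 0 ->
  vQ a * v beta ^+ i = vQ b * v beta ^+ j -> i = j.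
Proof.
move=> /padic_value_beta[k ->] /padic_value_beta[l ->].
rewrite !(exprnP (v beta)) -!expfzDr ?gt_eqF ?absv_beta_gt0//.
move/(@ieexprIz _ _ absv_beta_gt0 _) => /(_ (negbT (gt_eqF absv_beta_gt1))) H.
apply: val_inj => /=; have := ltn_ord i; have := ltn_ord j.
have := congr1 (fun z => (z %% e%:Z)%Z) H.
rewrite /= ![(e%:Z * _)%R]mulrC !modzMDl !modz_nat => -[+ je ie].
by rewrite !modn_small.
Qed.

(* The e powers of beta have distinct classes modulo the values of Qp, so by
   counting they exhaust the classes. *)
Lemma absv_value x : x != 0 ->
  exists2 a : Qp, a != 0 & exists i : 'I_e, v x = vQ a * v beta ^+ i.
Proof.
case: ram => r r0 cls.
have cls' y : y != 0 -> exists i : 'I_e, exists2 a, a != 0 & v y = vQ a * v (r i).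
  move=> y0; have [i [[a a0 ya] _]] := cls y (memvf _) y0.
  by exists i, a => //; rewrite -absv_scale.
have /choice[s Hs] : forall i : 'I_e, exists j : 'I_e,
    exists2 a, a != 0 & v (beta ^+ i) = vQ a * v (r j).
  by move=> i; apply: cls'; rewrite expf_neq0// beta_neq0.
have s_inj : injective s.
  move=> i j sij; have [a a0 Ha] := Hs i; have [b b0 Hb] := Hs j.
  apply: (absv_beta_inj b0 a0); rewrite -!absvX// Ha Hb sij; ring.
move=> x0; have [j [a a0 Ha]] := cls' _ x0.
have [t st ts] := injF_bij s_inj.
have [b b0 Hb] := Hs (t j).
exists (a / b); first by rewrite mulf_neq0// invr_eq0.
exists (t j); rewrite -absvX// Hb ts absvM// absvV// mulrA divfK//.
by rewrite absv_eq0.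
Qed.

Lemma absv_betaZ x : x != 0 -> exists k : int, v x = v beta ^ k.
Proof.
move=> /absv_value[a /padic_value_beta[k ->] [i ->]].
by exists (e%:Z * k + i%:Z); rewrite expfzDr ?gt_eqF// absv_beta_gt0.
Qed.

(** The nonzero values are integral powers of [v beta], so a smaller value is at least one power
    down. *)
Lemma absv_discrete x y : v x < v y -> v x <= v y / v beta.
Proof.
have [->|y0] := eqVneq y 0; first by rewrite absv0// ltNge absv_ge0.
have [->|x0] := eqVneq x 0; first by rewrite absv0// divr_ge0// absv_ge0.
have [k ->] := absv_betaZ x0; have [l ->] := absv_betaZ y0.
rewrite ltr_eXz2l ?absv_beta_gt1// => kl.
rewrite -exprN1 -expfzDr ?gt_eqF ?absv_beta_gt0// ler_eXz2l ?absv_beta_gt1//.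
by rewrite lerBrDr lezD1.
Qed.

Lemma absv_lt_beta x : (v x < v beta) = (v x <= 1).
Proof.
apply/idP/idP => [/absv_discrete|]; first by rewrite divff// gt_eqF// absv_beta_gt0.
by move=> /le_lt_trans; apply; exact: absv_beta_gt1.
Qed.

(** * Powers of gamma and the residue field *)

Let n := (p ^ f - 1)%N.
Let n_gt0 : (0 < n)%N.
Proof. exact: prim_order_gt0 prim. Qed.

Lemma absv_gamma : v gamma = 1.
Proof.
have /eqP := congr1 v (prim_expr_order prim); rewrite absvX// absv1//.
by rewrite pexpr_eq1 ?absv_ge0// => /eqP.
Qed.

Lemma absv_gammaX k : v (gamma ^+ k) = 1.
Proof. by rewrite absvX// absv_gamma expr1n. Qed.

(* Evaluate (X^n - 1) / (X - 1) at 1: the product of the 1 - gamma^i is n, which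
   is prime to p. *)
Lemma absv_1subgamma k : (0 < k < n)%N -> v (1 - gamma ^+ k) = 1.
Proof.
move=> /andP[k0 kn].
have prodE : \prod_(1 <= i < n) (1 - gamma ^+ i) = n%:R.
  have E : \prod_(1 <= i < n) ('X - (gamma ^+ i)%:P) = \sum_(i < n) 'X^i.
    apply: (mulfI (monic_neq0 (monicXsubC 1))); rewrite -[1 in RHS](expr0 gamma).
    by rewrite -big_ltn// (factor_Xn_sub_1 prim) subrX1 expr0 polyC1.
  have := congr1 (fun P => P.[1]) E.
  rewrite horner_prod horner_sum; under eq_bigr do rewrite hornerXsubC.
  by under [in X in _ = X]eq_bigr do rewrite hornerXn expr1n;
    rewrite sumr_const card_ord.
have le1 i : v (1 - gamma ^+ i) <= 1.
  by apply: ultraB => //; rewrite ?absv1 ?absv_gammaX.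
apply/le_anti; rewrite le1 /=.
have -> : 1 = v n%:R.
  rewrite ext_nat (padic_coprime p_prime compl)//.
  have f0 : (0 < f)%N by rewrite lt0n; apply: contraTneq n_gt0; rewrite /n => ->.
  rewrite prime_coprime// /n dvdn_subr ?expn_gt0 ?prime_gt0//.
    by rewrite dvdn1 gtn_eqF// prime_gt1.
  by rewrite dvdn_exp.
have prod_le1 a b : v (\prod_(a <= i < b) (1 - gamma ^+ i)) <= 1.
  apply: (big_ind (fun x => v x <= 1)); rewrite ?absv1// => x y x1 y1.
  by rewrite absvM// mulr_ile1 ?absv_ge0.
(* The other factors have value at most 1, so the factor at [k] is bounded below by the whole
   product, of value 1. *)
rewrite -prodE (@big_cat_nat _ _ _ k)//=; last exact: ltnW.
rewrite (absvM av) (big_ltn kn) (absvM av) mulrCA ler_piMr ?absv_ge0//.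
by rewrite mulr_ile1 ?absv_ge0.
Qed.

Lemma gammaX_sep i j : (i < n)%N -> (j < n)%N ->
  v (gamma ^+ i - gamma ^+ j) < 1 -> i = j.
Proof.
wlog ij : i j / (i <= j)%N => [W i_n j_n H|_ j_n].
  case/orP: (leq_total i j) => ij; first exact: W.
  by apply/esym/W; rewrite // absvB.
have -> : gamma ^+ i - gamma ^+ j = gamma ^+ i * (1 - gamma ^+ (j - i)).
  by rewrite mulrBr mulr1 -exprD subnKC.
rewrite absvM// absv_gammaX mul1r.
case: (posnP (j - i)%N) => [ji _|ji].
  by apply/eqP; rewrite eqn_leq ij -subn_eq0 ji.
by rewrite absv_1subgamma ?ltxx// ji (leq_ltn_trans (leq_subr _ _)).
Qed.

(** Expresses through representatives that the residue class of [x] lies in the span of the classes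
    of the first [d] powers of [gamma] over the residue field of [Qp]. *)
Definition residue_span d (x : K) : Prop :=
  exists2 c : nat -> Qp, (forall k, vQ (c k) <= 1) &
    v (x - \sum_(k < d) c k *: gamma ^+ k) < 1.

Lemma residue_spanD d x y :
  residue_span d x -> residue_span d y -> residue_span d (x + y).
Proof.
move=> [b b1 Hb] [c c1 Hc]; exists (fun k => b k + c k) => [k|].
  exact: ultraD.
under eq_bigr do rewrite scalerDl.
by rewrite big_split /= opprD addrACA ultraD_lt.
Qed.

Lemma residue_spanZ d a x : vQ a <= 1 -> residue_span d x -> residue_span d (a *: x).
Proof.
move=> a1 [c c1 Hc]; exists (fun k => a * c k) => [k|].
  by rewrite absvM// mulr_ile1// absv_ge0.
under eq_bigr do rewrite -scalerA.
rewrite -scaler_sumr -scalerBr absv_scale.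
by rewrite (le_lt_trans _ Hc)// ler_piMl// absv_ge0.
Qed.

Lemma residue_span_eq d x y : v (x - y) < 1 -> residue_span d y -> residue_span d x.
Proof. by move=> xy [c c1 Hc]; exists c => //; exact: ultra_trans_lt Hc. Qed.

Lemma residue_span0 d : residue_span d 0.
Proof.
exists (fun=> 0) => [k|]; first by rewrite absv0.
by rewrite big1 ?subr0 ?absv0// => i _; rewrite scale0r.
Qed.

Lemma residue_span_base d k : (k < d)%N -> residue_span d (gamma ^+ k).
Proof.
move=> kd; exists (fun i => (i == k)%:R) => [i|]; first by case: eqP.
rewrite (bigD1 (Ordinal kd)) //= eqxx scale1r big1 ?addr0 ?subrr ?absv0// => i.
by rewrite -val_eqE /= => /negbTE ->; rewrite scale0r.
Qed.

(** Once it contains [gamma ^+ d], the span is stable under multiplication by [gamma]. *)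
Lemma residue_spanX d k : residue_span d (gamma ^+ d) -> residue_span d (gamma ^+ k).
Proof.
move=> Hd; have base i : (i <= d)%N -> residue_span d (gamma ^+ i).
  by rewrite leq_eqVlt => /predU1P[-> //|]; exact: residue_span_base.
elim: k => [|k [c c1 Hc]]; first exact: base.
apply: (@residue_span_eq _ _ (gamma * \sum_(i < d) c i *: gamma ^+ i)).
  by rewrite exprS -mulrBr absvM// absv_gamma mul1r.
rewrite mulr_sumr; elim/big_ind: _; first exact: residue_span0.
  exact: residue_spanD.
move=> i _; rewrite -scalerAr -exprS.
by apply: residue_spanZ => //; apply: base; exact: ltn_ord.
Qed.

Definition residue_digits d (c : {ffun 'I_d -> 'I_p}) : K :=
  \sum_(i < d) (c i)%:R *: gamma ^+ i.

Lemma residue_span_digits d x : residue_span d x ->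
  exists c : {ffun 'I_d -> 'I_p}, v (x - residue_digits c) < 1.
Proof.
move=> [c c1 Hc].
have /choice[a Ha] : forall i : 'I_d, exists a : 'I_p, vQ (c i - a%:R) < 1.
  by move=> i; have [a ap Ha] := padic_residue p_prime compl (c1 i); exists (Ordinal ap).
exists [ffun i => a i]; apply: (ultra_trans_lt av vn Hc).
rewrite /residue_digits -sumrB; apply: ultra_sum_lt => // i _.
by rewrite ffunE -scalerBl absv_scale absv_gammaX mulr1.
Qed.

(* If gamma^d reduced to a combination of lower powers, then so would all powers
   of gamma; but 0 and the powers of gamma have p^f distinct residues, more than
   the p^d available combinations. *)
Lemma gammaX_notin_residue_span d : (d < f)%N -> ~ residue_span d (gamma ^+ d).
Proof.
move=> df Hd.
pose val_o (o : option 'I_n) := if o is Some i then gamma ^+ i else 0.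
have /choice[h Hh] : forall o, exists c : {ffun 'I_d -> 'I_p},
    v (val_o o - residue_digits c) < 1.
  case=> [i|]; apply: residue_span_digits; first exact: residue_spanX.
  exact: residue_span0.
have h_inj : injective h.
  move=> o o' oo'; have : v (val_o o - val_o o') < 1.
    by apply: (ultra_trans_lt av vn (Hh o)); rewrite oo' absvB.
  case: o o' {oo'} => [i|] [j|] //=; rewrite ?subr0 ?sub0r ?absvN// ?absv_gammaX ?ltxx//.
  by move=> /gammaX_sep ij; congr Some; apply: val_inj; exact: ij.
have := leq_card h h_inj; rewrite card_option card_ffun !card_ord /n subn1 prednK.
  by rewrite leq_exp2l ?prime_gt1// leqNgt df.
by rewrite expn_gt0 prime_gt0.
Qed.

(** Induction on the number of terms: a top coefficient of value 1 could be divided out, putting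
    [gamma ^+ d] in the span of the lower powers. *)
Lemma gammaX_residue_free (c : nat -> Qp) : (forall k, vQ (c k) <= 1) ->
  v (\sum_(k < f) c k *: gamma ^+ k) < 1 -> forall k, (k < f)%N -> vQ (c k) < 1.
Proof.
move=> c1; suff H d : (d <= f)%N -> v (\sum_(k < d) c k *: gamma ^+ k) < 1 ->
  forall k, (k < d)%N -> vQ (c k) < 1 by exact: H.
elim: d => [//|d IH] df; rewrite big_ord_recr /= => Hs.
have cd : vQ (c d) < 1.
  rewrite lt_neqAle c1 andbT; apply/eqP => cd1; apply: (gammaX_notin_residue_span df).
  have cd0 : c d != 0 by rewrite -(absv_eq0 avQ) cd1 oner_eq0.
  exists (fun k => - (c k / c d)) => [k|].
    by rewrite absvN// absvM// absvV// cd1 invr1 mulr1.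
  under eq_bigr do rewrite scaleNr mulrC -scalerA.
  rewrite sumrN opprK -scaler_sumr -[X in X + _](scalerK cd0) -scalerDr.
  by rewrite absv_scale absvV// cd1 invr1 mul1r addrC.
move=> k; rewrite ltnS leq_eqVlt => /predU1P[-> //|]; apply: IH; first exact: ltnW.
rewrite -[X in v X](addrK (c d *: gamma ^+ d)) ultraB_lt//.
by rewrite absv_scale absv_gammaX mulr1.
Qed.

(** Independence makes corresponding digits congruent modulo [p], and digits below [p] are then
    equal. *)
Lemma residue_digits_inj (c c' : {ffun 'I_f -> 'I_p}) :
  v (residue_digits c - residue_digits c') < 1 -> c = c'.
Proof.
move=> H.
pose C k : Qp := if insub k is Some i then (c i)%:R - (c' i)%:R else 0.
have CE (i : 'I_f) : C i = (c i)%:R - (c' i)%:R by rewrite /C valK.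
have C1 k : vQ (C k) <= 1.
  by rewrite /C; case: insub => [i|]; [exact: ultraB|rewrite absv0].
apply/ffunP => i; apply/val_inj.
apply: (padic_natB_eq (N := 0) p_prime compl); rewrite ?expn1 ?ltn_ord//=.
rewrite expr0 invr1 -CE; apply: gammaX_residue_free => //.
move: H; rewrite /residue_digits -sumrB; congr (v _ < 1).
by apply: eq_bigr => j _; rewrite CE scalerBl.
Qed.

Lemma residue_digits_le1 d (c : {ffun 'I_d -> 'I_p}) : v (residue_digits c) <= 1.
Proof. by apply: ultra_sum => // i _; rewrite absv_scale absv_gammaX mulr1. Qed.

(** By counting: reading digits in the basis [u] of the residue field maps the [p^f] digit vectors
    in [gamma] injectively to those in [u], hence bijectively. *)
Lemma residue_digits_surj x : v x <= 1 ->
  exists c : {ffun 'I_f -> 'I_p}, v (x - residue_digits c) < 1.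
Proof.
have [u [u1 u_span _]] := res.
have /choice[t Ht] : forall x, exists c : {ffun 'I_f -> 'I_p}, v x <= 1 ->
    v (x - \sum_i (c i)%:R *: u i) < 1.
  move=> y; have [y1|_] := boolP (v y <= 1); last first.
    by exists [ffun=> Ordinal (prime_gt0 p_prime)].
  have [c c1 Hc] := u_span y y1.
  have /choice[a Ha] : forall i : 'I_f, exists a : 'I_p, vQ (c i - a%:R) < 1.
    move=> i; have [|a ap Ha] := @padic_residue _ _ _ _ p_prime compl (c i).
      by rewrite -extQ.
    by exists (Ordinal ap).
  exists [ffun i => a i] => _; apply: (ultra_trans_lt av vn Hc).
  rewrite -sumrB; apply: ultra_sum_lt => // i _.
  rewrite ffunE -scalerBl absv_scale; apply: le_lt_trans (Ha i).
  by rewrite ler_piMr// absv_ge0.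
have t_inj : injective (t \o @residue_digits f).
  move=> c c' /= tcc'; apply: residue_digits_inj.
  by apply: (ultra_trans_lt av vn (Ht _ (residue_digits_le1 c)));
    rewrite tcc' absvB// Ht// residue_digits_le1.
have [g _ gK] := injF_bij t_inj.
move=> x1; exists (g (t x)); apply: (ultra_trans_lt av vn (Ht x x1)).
by rewrite absvB// -[t x in X in _ - X](gK (t x)) Ht// residue_digits_le1.
Qed.

(** * Coordinates with respect to the products of powers of gamma and beta *)

Local Notation fc := (@from_coords Qp K e f gamma beta).

Lemma absv_coord_term (a : Qp) i j : v (a *: (gamma ^+ j * beta ^+ i)) = vQ a * v beta ^+ i.
Proof. by rewrite absv_scale absvM// absv_gammaX mul1r absvX. Qed.

Lemma from_coordsB b c : fc (b - c) = fc b - fc c.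
Proof.
rewrite /from_coords -sumrB; apply: eq_bigr => i _.
by rewrite -sumrB; apply: eq_bigr => j _; rewrite !mxE scalerBl.
Qed.

Lemma from_coordsD b c : fc (b + c) = fc b + fc c.
Proof.
rewrite /from_coords -big_split /=; apply: eq_bigr => i _.
by rewrite -big_split; apply: eq_bigr => j _; rewrite !mxE scalerDl.
Qed.

(* For fixed i the residue independence of the powers of gamma gives the maximum
   over j; terms with distinct i have distinct values, so nothing cancels. *)
Lemma absv_coord_le (b : 'M[Qp]_(e, f)) i j : vQ (b i j) * v beta ^+ i <= v (fc b).
Proof.
pose G (q : 'I_e * 'I_f) := vQ (b q.1 q.2) * v beta ^+ q.1.
case: (@Order.TotalTheory.arg_maxP _ _ _ (i, j) xpredT G erefl) => -[i0 j0] _ Gmax.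
apply: (le_trans (Gmax (i, j) erefl)); rewrite leNgt; apply/negP => Hlt.
have {}Gmax q : G q <= G (i0, j0) by exact: (Gmax q erefl).
set M := G _ in Hlt Gmax.
have M0 : 0 < M by exact: le_lt_trans (absv_ge0 av _) Hlt.
have b0 : b i0 j0 != 0.
  by apply: contraTneq M0 => b0; rewrite /M /G /= b0 absv0// mul0r ltxx.
move: Hlt; rewrite /from_coords (bigD1 i0)//=; set A := \sum_(k < f) _.
set B := \sum_(k < e | _) _ => Hlt.
have HB : v B < M.
  apply: ultra_sum_lt => // k ki0; apply: ultra_sum_lt => // l _.
  rewrite absv_coord_term lt_neqAle (Gmax (k, l) : vQ (b k l) * v beta ^+ k <= M) andbT.
  have [->|bkl] := eqVneq (b k l) 0; first by rewrite absv0// mul0r lt_eqF.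
  by apply: contra ki0 => /eqP /absv_beta_inj ->.
have : v A < M by rewrite -[A](addrK B) ultraB_lt.
(* Dividing row [i0] by its largest entry makes the coefficients integral with a 1 at [j0], which
   contradicts [gammaX_residue_free]. *)
pose C k : Qp := if insub k is Some l then b i0 l / b i0 j0 else 0.
have CE (l : 'I_f) : C l = b i0 l / b i0 j0 by rewrite /C valK.
have b0' : 0 < vQ (b i0 j0) by rewrite absv_gt0.
have bX k : 0 < v beta ^+ k by rewrite exprn_gt0// absv_beta_gt0.
have -> : A = b i0 j0 *: (beta ^+ i0 * \sum_(k < f) C k *: gamma ^+ k).
  rewrite mulr_sumr scaler_sumr; apply: eq_bigr => l _.
  rewrite CE -scalerAr scalerA mulrCA divff// mulr1; congr (_ *: _).
  by rewrite mulrC.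
rewrite absv_scale absvM// absvX// mulrA gtr_pMr ?mulr_gt0// => Hs.
have C1 k : vQ (C k) <= 1.
  rewrite /C; case: insub => [l|]; last by rewrite absv0.
  rewrite absvM// absvV// ler_pdivrMr// mul1r -(ler_pM2r (bX i0)).
  exact: (Gmax (i0, l)).
have := gammaX_residue_free C1 Hs (ltn_ord j0).
by rewrite CE divff// absv1// ltxx.
Qed.

Lemma from_coords_le (b : 'M[Qp]_(e, f)) M : 0 <= M ->
  (forall i j, vQ (b i j) * v beta ^+ i <= M) -> v (fc b) <= M.
Proof.
move=> M0 H; apply: ultra_sum => // i _; apply: ultra_sum => // j _.
by rewrite absv_coord_term.
Qed.

Lemma from_coords_lt (b : 'M[Qp]_(e, f)) M : 0 < M ->
  (forall i j, vQ (b i j) * v beta ^+ i < M) -> v (fc b) < M.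
Proof.
move=> M0 H; apply: ultra_sum_lt => // i _; apply: ultra_sum_lt => // j _.
by rewrite absv_coord_term.
Qed.

(** Divide [x] by a monomial [a *: beta ^+ i] of the same value and replace the quotient by its
    residue digits; the error drops strictly, hence by a full factor [v beta]. *)
Lemma from_coords_approx x : exists b, v (x - fc b) <= v x / v beta.
Proof.
have [->|x0] := eqVneq x 0.
  exists 0; rewrite sub0r absvN// absv0// mul0r from_coords_le// => i j.
  by rewrite mxE absv0// mul0r.
have [a a0 [i xai]] := absv_value x0.
have z0 : a *: beta ^+ i != 0.
  by rewrite -(absv_gt0 av) absv_scale absvX// -xai absv_gt0.
have [|c Hc] := @residue_digits_surj (x / (a *: beta ^+ i)).
  by rewrite absvM// absvV// absv_scale absvX// -xai divff// absv_eq0.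
exists (\matrix_(k, j) (if k == i then a * (c j)%:R else 0)).
set y := fc _; have -> : y = a *: beta ^+ i * residue_digits c.
  rewrite /y /from_coords (bigD1 i)//= [X in _ + X]big1 ?addr0 => [|k /negbTE ki].
    rewrite /residue_digits mulr_sumr; apply: eq_bigr => j _.
    rewrite !mxE eqxx -scalerAl -scalerAr scalerA; congr (_ *: _).
    exact: mulrC.
  by apply: big1 => j _; rewrite !mxE ki scale0r.
apply: absv_discrete.
have -> : x - a *: beta ^+ i * residue_digits c =
    a *: beta ^+ i * (x / (a *: beta ^+ i) - residue_digits c).
  by rewrite mulrBr mulrCA divff// mulr1.
by rewrite absvM// absv_scale absvX// -xai gtr_pMr ?absv_gt0.
Qed.

(** Iterating the approximation gives matrices [s k]; [absv_coord_le] makes their entries Cauchy,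
    and completeness of [Qp] supplies the limits. *)
Lemma from_coords_surj x : exists b, x = fc b.
Proof.
have /choice[g Hg] := from_coords_approx.
have w1 := absv_beta_gt1; have w0 := absv_beta_gt0.
pose s k := iter k (fun b => b + g (x - fc b)) 0.
pose r k := v x * (v beta)^-1 ^+ k.
have rS k : r k.+1 = r k / v beta by rewrite /r exprSr mulrA.
have r_ge0 k : 0 <= r k by rewrite mulr_ge0 ?(absv_ge0 av)// exprn_ge0// invr_ge0 ltW.
have r_le k l : (k <= l)%N -> r l <= r k.
  move=> kl; rewrite ler_wpM2l ?(absv_ge0 av)// ler_wiXn2l ?invr_ge0 ?invf_le1//; exact: ltW.
have r_cvg : r k @[k --> \oo] --> (0 : R).
  rewrite -[X in _ --> X](mulr0 (v x)); apply: cvgM; first exact: cvg_cst.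
  by apply: cvg_expr; rewrite ger0_norm ?invr_ge0 ?ltW// invf_lt1.
have r_small eps : 0 < eps -> \forall k \near \oo, r k < eps.
  move=> e0; have /cvgrPdist_lt/(_ eps e0) := r_cvg.
  by apply: filterS => k; rewrite sub0r normrN ger0_norm.
have s_approx k : v (x - fc (s k)) <= r k.
  elim: k => [|k IH].
    rewrite /r expr0 mulr1 /= (_ : fc 0 = 0) ?subr0//.
    by rewrite -[LHS]addr0 -{1}(subrr (0 : 'M[Qp]_(e, f))) from_coordsB subrr addr0.
  rewrite rS /= from_coordsD opprD addrA; apply: (le_trans (Hg _)).
  by rewrite ler_pM2r// invr_gt0.
have s_cauchy i j k l m : (k <= l)%N -> (k <= m)%N -> vQ (s l i j - s m i j) <= r k.
  move=> kl km; have wi : 1 <= v beta ^+ i by rewrite exprn_ege1// ltW.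
  apply: (@le_trans _ _ (v (fc (s l - s m)))).
    apply: le_trans (absv_coord_le _ i j); rewrite !mxE.
    by rewrite ler_peMr// absv_ge0.
  rewrite from_coordsB; apply: (@ultra_trans _ _ _ av vn _ _ x).
    by rewrite absvB//; apply: (le_trans (s_approx l)); exact: r_le.
  by apply: (le_trans (s_approx m)); exact: r_le.
have /choice[l Hl] (ij : 'I_e * 'I_f) : exists l : Qp,
    vQ (s k ij.1 ij.2 - l) @[k --> \oo] --> (0 : R).
  case: (compl) => _ _ _; apply => eps e0.
  have [N _ HN] := r_small eps e0; exists N => m n' Nm Nn.
  by apply: le_lt_trans (HN N (leqnn _)); exact: s_cauchy.
exists (\matrix_(i, j) l (i, j)); set b := \matrix_(i, j) _.
apply/eqP; rewrite -subr_eq0 -(absv_eq0 av) eq_le absv_ge0// andbT.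
rewrite leNgt; apply/negP => eps0; set eps := v _ in eps0.
(* The divisor [v beta ^+ e] absorbs the weights [v beta ^+ i] with [i < e]. *)
have d0 : 0 < eps / v beta ^+ e by rewrite divr_gt0// exprn_gt0.
have : \forall k \near \oo, r k < eps /\
    forall ij : 'I_e * 'I_f, vQ (s k ij.1 ij.2 - l ij) < eps / v beta ^+ e.
  apply: filterI; first exact: r_small.
  apply: (@filter_forall nat ('I_e * 'I_f)%type (fun ij k =>
    vQ (s k ij.1 ij.2 - l ij) < eps / v beta ^+ e) \oo _) => ij.
  have /cvgrPdist_lt/(_ _ d0) := Hl ij.
  by apply: filterS => k; rewrite sub0r normrN ger0_norm// absv_ge0.
case=> N _ /(_ N (leqnn _))[rN lN].
suff : v (x - fc b) < eps by rewrite ltxx.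
apply: (@ultra_trans_lt _ _ _ av vn _ _ (fc (s N))).
  exact: le_lt_trans (s_approx N) rN.
rewrite -from_coordsB; apply: from_coords_lt => // i j; rewrite !mxE.
apply: (@le_lt_trans _ _ (vQ (s N i j - l (i, j)) * v beta ^+ e)).
  by rewrite ler_wpM2l ?(absv_ge0 avQ)// ler_weXn2l ?(ltW w1)// ltnW.
by rewrite -ltr_pdivlMr ?exprn_gt0//; exact: (lN (i, j)).
Qed.

(** * The floor on K *)

Definition cf_floor_value (c : K) : Prop :=
  exists2 b : 'M[Qp]_(e, f), (forall i j, floor_value p (b i j)) & c = fc b.

Lemma coordsK x : fc (coords e f gamma beta x) = x.
Proof.
rewrite /coords; case: xgetP => [b _ //|]; have [b ->] := from_coords_surj x.
by move=> /(_ b) [].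
Qed.

Lemma cf_floorP x : cf_floor_value (cf_floor p vQ e f gamma beta x) /\
  v (x - cf_floor p vQ e f gamma beta x) < 1.
Proof.
split.
  exists (\matrix_(i, j) padic_floor p vQ (coords e f gamma beta x i j)) => //.
  by move=> i j; rewrite mxE;
    case: (padic_floorP p_prime compl (coords e f gamma beta x i j)).
rewrite -{1}[x]coordsK /cf_floor -from_coordsB; apply: from_coords_lt => // i j.
rewrite !mxE; set a := _ - _.
have a1 : vQ a < 1 by case: (padic_floorP p_prime compl (coords e f gamma beta x i j)).
have [->|/padic_value_beta[k ak]] := eqVneq a 0; first by rewrite absv0// mul0r.
have w0 := absv_beta_gt0; have w1 := absv_beta_gt1.
move: a1; rewrite ak (exprnP _ i) -expfzDr ?gt_eqF// -(expr0z (v beta)) !ltr_eXz2l//.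
rewrite pmulr_rlt0 ?ltz_nat ?ramification_gt0// => k0.
(* From [k <= -1] the exponent [e k + i] is at most [i - e], which is negative: a fractional part of
   value at most [1/p] outweighs [v beta ^+ i]. *)
have : e%:Z * (k + 1) <= 0 by rewrite mulr_ge0_le0// lezD1.
by have := ltn_ord i; lia.
Qed.

(** The weights [v beta ^+ i] are at least 1, so each coordinate of [c - c'] has value below 1 and
    [floor_value_eq] applies entrywise. *)
Lemma cf_floor_value_eq c c' :
  cf_floor_value c -> cf_floor_value c' -> v (c - c') < 1 -> c = c'.
Proof.
move=> [b Fb ->] [b' Fb' ->]; rewrite -from_coordsB => H; congr (fc _).
apply/matrixP => i j; apply: (floor_value_eq p_prime compl) => //.
apply: le_lt_trans H; apply: le_trans (absv_coord_le _ i j); rewrite !mxE.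
by rewrite ler_peMr ?(absv_ge0 avQ)// exprn_ege1// ltW// absv_beta_gt1.
Qed.

Lemma cf_floor_value_countable : countable [set c | cf_floor_value c].
Proof.
pose g (m : 'M[(nat * nat)%type]_(e, f)) : K :=
  fc (\matrix_(i, j) ((m i j).2%:R / p%:R ^+ (m i j).1)).
apply: (@sub_countable _ _ _ (range g)); last first.
  exact: sub_countable (card_image_le _ _) (countableP _).
apply: subset_card_le => c [b Fb ->].
have /choice[m Hm] (ij : 'I_e * 'I_f) : exists q : nat * nat,
    b ij.1 ij.2 = q.2%:R / p%:R ^+ q.1.
  by have [n' [s [_ ->]]] := Fb ij.1 ij.2; exists (n', s).
exists (\matrix_(i, j) m (i, j)) => //; congr (fc _).
by apply/matrixP => i j; rewrite !mxE (Hm (i, j)).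
Qed.

End Structure.

(** * Balls under a translation-invariant measure *)

Section BallMeasure.
Variables (R : realType) (K : fieldType) (v : K -> R) (beta : K).
Hypotheses (av : absolute_value v) (vn : forall n, v n%:R <= 1)
  (beta_gt1 : 1 < v beta)
  (v_value : forall x, x != 0 -> exists k : int, v x = v beta ^ k)
  (v_beta : forall x, v x < v beta -> v x <= 1).
Variables (D : finType) (digit : D -> K).
Hypotheses (digit_inj : forall i j, v (digit i - digit j) < 1 -> i = j)
  (digit_surj : forall x, v x <= 1 -> exists i, v (x - digit i) < 1)
  (digit_le1 : forall i, v (digit i) <= 1).
Variables (F : set K) (fl : K -> K).
Hypotheses (F_countable : countable F)
  (F_eq : forall c c', F c -> F c' -> v (c - c') < 1 -> c = c')
  (flP : forall x, F (fl x) /\ v (x - fl x) < 1).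

Let X := borel (valued v).
Variable mu : {measure set X -> \bar R}.
Let B : set X := [set x : K | v x < 1].
Hypotheses
  (mu_transl : forall (a : K) (E : set X), measurable E ->
     mu [set (a + x : K) | x in (E : set K)] = mu E)
  (mu_unit : mu (B) = 1%E).

Let w0 : 0 < v beta. Proof. exact: lt_trans beta_gt1. Qed.
Let beta0 : beta != 0. Proof. by rewrite -(absv_gt0 av). Qed.

Let wX_gt0 k : 0 < v beta ^+ k. Proof. by rewrite exprn_gt0. Qed.
Let wXV_gt0 k : 0 < v beta ^- k. Proof. by rewrite invr_gt0. Qed.
Let wXV_le1 k : v beta ^- k <= 1.
Proof. by rewrite invf_le1// exprn_ege1// ltW. Qed.

Let wXV_small eps : 0 < eps -> exists k, v beta ^- k < eps.
Proof.
move=> e0; have w1 : `|(v beta)^-1| < 1.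
  by rewrite ger0_norm ?invr_ge0 ?ltW// invf_lt1.
have /cvgrPdist_lt/(_ eps e0)[N _ /(_ N (leqnn _))] := cvg_expr w1.
by rewrite /= sub0r normrN exprVn ger0_norm ?ltW//; exists N.
Qed.

Definition cball (k : nat) (y : K) : set X := [set x : K | v (x - y) < v beta ^- k].

Lemma cball_unit y : v y < 1 -> cball 0 y = B.
Proof.
move=> y1; apply/seteqP; split=> x /=; rewrite /cball /B /= expr0 invr1 => Hx.
  by rewrite -(subrK y x); exact: ultraD_lt.
exact: ultraB_lt.
Qed.

Lemma cball_eq k x y : cball k y x -> cball k y = cball k x.
Proof.
rewrite /cball /= => xy; apply/seteqP; split => z /= Hz; last exact: ultra_trans_lt xy.
by apply: ultra_trans_lt Hz _; rewrite // absvB.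
Qed.

Lemma cball_le k l y : (k <= l)%N -> cball l y `<=` cball k y.
Proof.
move=> kl x /= /lt_le_trans; apply.
by rewrite lef_pV2 ?posrE// ler_weXn2l// ltW.
Qed.

Lemma open_cball k y : open (cball k y : set (valued v)).
Proof.
move=> x Hx; exists (v beta ^- k) => // z Hz.
by rewrite (cball_eq Hx).
Qed.

Lemma measurable_cball k y : measurable (cball k y).
Proof. by apply: sub_sigma_algebra; exact: open_cball. Qed.

Lemma mu_cball k y : mu (cball k y) = mu (cball k 0).
Proof.
rewrite -(mu_transl y (measurable_cball k 0)); congr (mu _).
apply/seteqP; split => [x Hx|_ [x Hx <-]].
  exists (x - y); last by rewrite addrC subrK.
  by rewrite /cball /= subr0.
by move: Hx; rewrite /cball /= subr0 [y + x]addrC addrK.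
Qed.

(** The empty set is included to obtain a pi-system, as two balls are either nested or disjoint. *)
Definition cballs : set (set X) := [set E | E = set0 \/ exists k y, E = cball k y].

Lemma cballs_setI : setI_closed cballs.
Proof.
move=> E E' [->|[k [x ->]]]; first by left; rewrite set0I.
move=> [->|[l [y ->]]]; first by left; rewrite setI0.
have [->|/set0P[z [Hx Hy]]] := eqVneq (cball k x `&` cball l y) set0.
  by left.
right; rewrite (cball_eq Hx) (cball_eq Hy).
case/orP: (leq_total k l) => kl.
  by exists l, z; rewrite setIidr//; exact: cball_le.
by exists k, z; rewrite setIidl//; exact: cball_le.
Qed.

(** Turns countability of the floor values into an indexing by naturals, so that decompositions by
    floor become countable unions. *)
Lemma exists_code : exists code : K -> nat,
  forall x y, code (fl x) = code (fl y) -> fl x = fl y.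
Proof.
have /countable_injP[c c_inj] := F_countable; exists c => x y.
by apply: c_inj; rewrite inE; case: (flP x) (flP y) => ? _ [].
Qed.

Lemma fl_eq x c : F c -> v (x - c) < 1 -> fl x = c.
Proof.
move=> Fc xc; have [Ff Hf] := flP x; apply: F_eq => //.
by apply: ultra_trans_lt xc; rewrite // absvB.
Qed.

Lemma fl_eqP x y : (v (x - y) < 1) <-> (fl x = fl y).
Proof.
split=> [xy|xy]; last first.
  apply: (ultra_trans_lt av vn (flP x).2); rewrite xy absvB//; exact: (flP y).2.
by apply: fl_eq; [exact: (flP y).1|apply: (ultra_trans_lt av vn xy (flP y).2)].
Qed.

(** Scaling by [beta ^+ k] brings the radius to 1, and balls of radius 1 are the fibres of [fl]; so
    there are countably many balls of each radius. *)
Lemma cball_fl k x y : cball k y x <-> fl (x * beta ^+ k) = fl (y * beta ^+ k).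
Proof.
rewrite -fl_eqP -mulrBl absvM// absvX// -ltr_pdivlMr// div1r; split=> H; exact: H.
Qed.

(** An open set is the union of the balls inside it, a countable union when they are indexed by [k]
    and the code of a floor. *)
Lemma measurable_cballs : @measurable _ X = <<s cballs >>.
Proof.
apply/seteqP; split; apply: smallest_sub; try exact: smallest_sigma_algebra; last first.
  move=> _ [->|[k [y ->]]]; first exact: measurable0.
  exact: measurable_cball.
move=> U oU; have [s0 _ sU] := smallest_sigma_algebra setT cballs.
have [code code_inj] := exists_code.
pose H k n := [set x | cball k x `<=` U /\ code (fl (x * beta ^+ k)) = n].
have -> : U = \bigcup_k \bigcup_n H k n.
  apply/seteqP; split => [x Ux|x [k _ [n _ [+ _]]]]; last first.
    by apply; apply/cball_fl.
  have [eps eps0 Hx] : exists2 eps : R, 0 < eps & forall y : K, v (y - x) < eps -> U y.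
    exact: oU.
  have [k Hk] := wXV_small eps0.
  exists k => //; exists (code (fl (x * beta ^+ k))) => //; split=> // y Hy.
  by apply: Hx; exact: lt_trans Hy Hk.
apply: (sU) => k; apply: (sU) => n.
(* Each [H k n] is empty or a single ball, since its code determines the ball. *)
have [->//|/set0P[x [HU Hn]]] := eqVneq (H k n) set0.
apply: sub_sigma_algebra; right; exists k, x; apply/seteqP; split=> z.
  by move=> [_ zn]; apply/cball_fl; apply: code_inj; rewrite zn Hn.
move=> zx; split; first by rewrite -(cball_eq zx).
by move/cball_fl: zx => ->.
Qed.

Lemma digit_card_gt1 : (1 < #|D|)%N.
Proof.
have [i Hi] : exists i, v (0 - digit i) < 1 by apply: digit_surj; rewrite absv0.
have [j Hj] : exists j, v (1 - digit j) < 1 by apply: digit_surj; rewrite absv1.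
apply/card_gt1P; exists i, j; split => //; apply/eqP => ij.
suff : v (1 - 0) < 1 by rewrite subr0 absv1// ltxx.
by apply: (ultra_trans_lt av vn Hj); rewrite -ij absvB.
Qed.

Lemma cball_split k y : cball k y =
  \bigcup_(i in [set: D]) cball k.+1 (y + digit i / beta ^+ k.+1).
Proof.
have bX m : beta ^+ m != 0 by rewrite expf_neq0.
apply/seteqP; split=> [x Hx|x [i _]]; rewrite /cball /=.
  have [|i Hi] := @digit_surj ((x - y) * beta ^+ k.+1).
    (* The scaled difference has value below [v beta], hence at most 1, so a digit approximates
       it. *)
    apply: v_beta; rewrite absvM// absvX// exprS mulrCA gtr_pMr//.
    by rewrite -ltr_pdivlMr// div1r.
  exists i => //; rewrite /cball /= -[ltRHS]mul1r ltr_pdivlMr// -absvX// -absvM//.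
  by rewrite opprD addrA mulrBl divfK.
move=> Hi; rewrite -(subrK (digit i / beta ^+ k.+1) (x - y)).
apply: ultraD_lt => //.
  rewrite -addrA -opprD; apply: (lt_trans Hi).
  by rewrite ltf_pV2 ?posrE// ltr_eXn2l.
rewrite absvM// absvV// absvX//; apply: (le_lt_trans (ler_piMl _ (digit_le1 i))).
  by rewrite ltW.
by rewrite ltf_pV2 ?posrE// ltr_eXn2l.
Qed.

Lemma cball_split_triv k y :
  trivIset [set: D] (fun i => cball k.+1 (y + digit i / beta ^+ k.+1)).
Proof.
have bX m : beta ^+ m != 0 by rewrite expf_neq0.
move=> i j _ _ [x [Hi Hj]]; apply: digit_inj.
have : v ((y + digit i / beta ^+ k.+1) - (y + digit j / beta ^+ k.+1)) < v beta ^- k.+1.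
  by apply: (ultra_trans_lt av vn _ Hj); rewrite absvB.
rewrite opprD addrACA subrr add0r -mulrBl absvM// absvV// absvX//.
by rewrite -[ltRHS]mul1r ltr_pM2r.
Qed.

(* Applied to g = id and to the continued fraction map. *)
Lemma mu_preim_cball (g : X -> X) : (forall x, B x -> B (g x)) ->
  (forall k y, B y -> measurable (B `&` g @^-1` cball k y)) ->
  (forall k y, B y -> mu (B `&` g @^-1` cball k y) = mu (B `&` g @^-1` cball k 0)) ->
  forall k y, B y -> mu (B `&` g @^-1` cball k y) = (#|D|%:R^-1 ^+ k)%:E.
Proof.
move=> gB gm ginv k y By; rewrite ginv//.
elim: k {y By} => [|k IH].
  rewrite cball_unit /= ?absv0// setIidl; first by rewrite expr0.
  by move=> x /gB.
have B_center i : B (0 + digit i / beta ^+ k.+1).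
  rewrite /B /= add0r absvM// absvV// absvX//.
  apply: (le_lt_trans (ler_piMl _ (digit_le1 i))); first by rewrite ltW.
  by rewrite invf_lt1// exprn_egt1.
have N0 : #|D|%:R != 0 :> R.
  by rewrite pnatr_eq0 -lt0n (ltn_trans _ digit_card_gt1).
(* The [#|D|] disjoint subballs of [cball k 0] have preimages of equal mass by [ginv]. *)
have H : (#|D|%:R%:E * mu (B `&` g @^-1` cball k.+1 0) = (#|D|%:R^-1 ^+ k)%:E)%E.
  rewrite -IH [in RHS]cball_split preimage_bigcup setI_bigcupr.
  rewrite measure_fin_bigcup; [|exact: finite_finset| |by move=> i _; exact: gm].
    have -> : [set: D] = [set` enum D] by apply/seteqP; split => i //= _; rewrite mem_enum.
    rewrite -fsbig_seq ?enum_uniq// big_enum /=.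
    rewrite (eq_bigr (fun=> mu (B `&` g @^-1` cball k.+1 0))).
      by rewrite sumr_const mule_natl.
    by move=> i _; exact: ginv.
  move=> i j _ _ [x [[_ Hi] [_ Hj]]].
  by apply: (cball_split_triv (k := k) (y := 0)) => //; exists (g x).
rewrite exprS EFinM -H muleA -EFinM mulVf// mul1e.
by [].
Qed.

(** * The continued fraction map for an abstract floor [fl] *)

Definition gauss_map (x : X) : X :=
  if (x : K) == 0 then (0 : K) else (x : K)^-1 - fl (x : K)^-1.
Local Notation T := gauss_map.

Lemma gauss_map_unit x : B (T x).
Proof.
rewrite /B /T /=; case: ifP => _; first by rewrite absv0.
exact: (flP _).2.
Qed.

(* The points of the unit ball whose first partial quotient is c and whose image
   lies in a ball are the inverses of the points of a translated ball; as
   v (c + y) = v c > 1, they form a ball whose radius depends only on v c. *)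
Lemma gauss_cell (c : K) : F c -> 1 < v c -> exists l, forall k y, B y ->
  [set x : K | [/\ B x, x != 0, fl x^-1 = c & cball k y (T x)]] =
  cball (k + 2 * l) (c + y)^-1.
Proof.
move=> Fc c1.
have c0 : c != 0 by rewrite -(absv_gt0 av) (lt_trans ltr01).
have [l vc] : exists l, v c = v beta ^+ l.
  have [[l|l] vl] := v_value c0; first by exists l.
  by move: c1; rewrite vl NegzE -exprnN ltNge wXV_le1.
exists l => k y By; set z := c + y.
have wl1 : 1 < v beta ^+ l by rewrite -vc.
have vz : v z = v beta ^+ l.
  rewrite -vc; apply: (ultra_eq av vn); rewrite /z opprD addrA subrr add0r absvN//.
  exact: lt_trans By c1.
have z0 : z != 0 by rewrite -(absv_gt0 av) vz.
(* Inversion multiplies distances by [v z / v x], which is [v beta ^+ (2 * l)] here. *)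
have distE x : x != 0 -> v x = v beta ^- l ->
    v (x^-1 - z) < v beta ^- k = (v (x - z^-1) < v beta ^- (k + 2 * l)).
  move=> x0 vx; have -> : x^-1 - z = - (x - z^-1) * (z / x).
    by rewrite mulNr mulrBl mulrA; field; rewrite x0 z0.
  rewrite absvM// absvN// absvM// absvV// vz vx invrK -exprD addnn -mul2n.
  by rewrite exprD invfM mulrC -ltr_pdivlMl// mulrC.
apply/seteqP; split => x.
  move=> [Bx x0 flx]; rewrite /cball /= /T (negbTE x0) flx -addrA -opprD => Hx.
  suff vx : v x = v beta ^- l by rewrite -distE.
  have vxV : v x^-1 = v z.
    apply: (ultra_eq av vn); rewrite absvB// vz.
    by apply: lt_trans wl1; apply: lt_le_trans Hx _.
  by rewrite -vz -vxV absvV// invrK.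
rewrite /cball /= => Hx.
(* The radius [v beta ^- (k + 2 * l)] is below [v z^-1], so [x] has the value of the centre. *)
have vx : v x = v beta ^- l.
  rewrite -vz -absvV//; apply: (ultra_eq av vn); rewrite absvB// absvV// vz.
  apply: (lt_trans Hx); rewrite ltf_pV2 ?posrE//.
  apply: (@lt_le_trans _ _ (v beta ^+ (2 * l))).
    by rewrite mul2n -addnn exprD ltr_pMl.
  by rewrite ler_weXn2l ?leq_addl// ltW.
have x0 : x != 0 by rewrite -(absv_gt0 av) vx.
have Hz : v (x^-1 - z) < v beta ^- k by rewrite distE.
have flx : fl x^-1 = c.
  apply: fl_eq => //; rewrite -(subrK y (x^-1 - c)); apply: ultraD_lt => //.
  by rewrite -addrA -opprD; apply: lt_le_trans Hz _.
split=> //; first by rewrite /B /= vx invf_lt1.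
by rewrite /T (negbTE x0) flx -addrA -opprD.
Qed.

Lemma measurable_origin : measurable ([set 0 : K] : set X).
Proof.
have -> : [set 0 : K] = \bigcap_k cball k 0.
  apply/seteqP; split=> [x -> k _|x H]; first by rewrite /cball /= subr0 absv0.
  apply/eqP; rewrite -(absv_eq0 av) eq_le absv_ge0// andbT leNgt; apply/negP => x0.
  have [k Hk] := wXV_small x0.
  by have := H k I; rewrite /cball /= subr0 ltNge ltW.
by apply: bigcapT_measurable => k; exact: measurable_cball.
Qed.

Lemma mu_cball_unit k y : B y -> mu (B `&` cball k y) = (#|D|%:R^-1 ^+ k)%:E.
Proof.
apply: (@mu_preim_cball id) => // {}k {}y By.
  by apply: measurableI; [rewrite -(cball_unit By)|]; exact: measurable_cball.
have sub z : B z -> B `&` cball k z = cball k z.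
  by move=> Bz; rewrite setIidr// -(cball_unit Bz); exact: cball_le.
by rewrite !sub ?mu_cball// /B /= absv0.
Qed.

(** The origin lies in balls of arbitrarily small mass; being null, it can be split off where the
    map is defined separately. *)
Lemma mu_origin : mu ([set 0 : K] : set X) = 0%E.
Proof.
apply/le_anti; rewrite measure_ge0 andbT; apply/lee_addgt0Pr => eps eps0.
have N1 : 1 < #|D|%:R :> R by rewrite ltr1n digit_card_gt1.
have Nv : `|#|D|%:R^-1| < 1 :> R.
  by rewrite ger0_norm ?invr_ge0// invf_lt1// (lt_trans ltr01).
have /cvgrPdist_lt/(_ eps eps0)[k _ /(_ k (leqnn _))] := cvg_expr Nv.
rewrite /= sub0r normrN ger0_norm ?exprn_ge0 ?invr_ge0// add0e => Hk.
have B0 : B (0 : K) by rewrite /B /= absv0.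
apply: (@le_trans _ _ (#|D|%:R^-1 ^+ k)%:E); last by rewrite lee_fin ltW.
rewrite -(mu_cball_unit k B0); apply: le_measure; rewrite ?inE.
- exact: measurable_origin.
- by apply: measurableI; [rewrite -(cball_unit B0)|]; exact: measurable_cball.
- by move=> _ ->; split=> //; rewrite /cball /= subrr absv0.
Qed.

Lemma gauss_preim_cball k y : B y ->
  measurable (B `&` T @^-1` cball k y) /\
  mu (B `&` T @^-1` cball k y) = mu (B `&` T @^-1` cball k 0).
Proof.
have [code code_inj] := exists_code.
pose cell n k y : set X :=
  [set x : K | [/\ B x, x != 0, code (fl x^-1) = n & cball k y (T x)]].
(* The alternative depends on [n] only, so one pair [l], [c] serves all [k] and [y], and empty cells
   are empty for every [y] of the unit ball. *)
have cellP n : (forall k y, B y -> cell n k y = set0) \/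
    exists l c, forall k y, B y -> cell n k y = cball (k + 2 * l) (c + y)^-1.
  have [[x [Bx x0 nx]]|noc] :=
      pselect (exists x : K, [/\ B x, x != 0 & code (fl x^-1) = n]).
    right; set c := fl x^-1; have [Fc cx] := flP x^-1.
    have x1 : 1 < v x^-1 by rewrite absvV// invf_gt1// absv_gt0.
    have vc : 1 < v c by rewrite (@ultra_eq _ _ _ av vn x^-1)// (lt_trans cx).
    have [l Hl] := gauss_cell Fc vc; exists l, c => k' y' By'.
    rewrite -Hl//; apply/seteqP; split => t [Bt t0 nt Tt]; split => //.
      by apply: code_inj; rewrite nt nx.
    by rewrite nt.
  left=> k' y' By'; apply/seteqP; split=> // t [Bt t0 nt _].
  by apply: noc; exists t.
have mcell n k' y' : B y' -> measurable (cell n k' y').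
  by move=> By'; case: (cellP n) => [|[l [c]]] ->//; exact: measurable_cball.
have mu_cell n k' y' : B y' -> mu (cell n k' y') = mu (cell n k' (0 : K)).
  have B0 : B (0 : K) by rewrite /B /= absv0.
  by move=> By'; case: (cellP n) => [|[l [c]]] H; rewrite !H// !(mu_cball _ (_ + _)^-1).
have tcell k' y' : trivIset setT (fun n => cell n k' y').
  by move=> m n _ _ [x [[_ _ <- _] [_ _ <- _]]].
have cellsE k' y' : B `&` T @^-1` cball k' y' =
    (\bigcup_n cell n k' y') `|` ([set 0 : K] `&` cball k' y').
  apply/seteqP; split=> [x [Bx Tx]|x [[n _ [Bx _ _ Tx]]|[-> H]]].
  - have [x0|x0] := eqVneq (x : K) 0; last by left; exists (code (fl (x : K)^-1)).
    by right; split=> //; move: Tx; rewrite /= /T x0 eqxx.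
  - by split.
  - by split; rewrite /B /= ?absv0// /T eqxx.
have m0 k' y' : measurable ([set 0 : K] `&` cball k' y' : set X).
  by apply: measurableI; [exact: measurable_origin|exact: measurable_cball].
have mU k' y' : B y' -> measurable (\bigcup_n cell n k' y').
  by move=> By'; apply: bigcupT_measurable => n; exact: mcell.
have muE k' y' : B y' -> mu (B `&` T @^-1` cball k' y') =
    (\sum_(n <oo) mu (cell n k' (0%R : K)))%E.
  move=> By'; rewrite cellsE measureU0//; last 2 first.
  - exact: mU.
  - apply: (subset_measure0 (m0 _ _) measurable_origin _ mu_origin).
    by move=> x [].
  rewrite measure_semi_bigcup//; last 2 first.
  - by move=> n; exact: mcell.
  - exact: mU.
  by apply: eq_eseriesr => n _; exact: mu_cell.
move=> By; split; first by rewrite cellsE; apply: measurableU => //; exact: mU.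
by rewrite !muE// /B /= absv0.
Qed.

(** Dynkin induction on [cballs], carrying measurability of the preimage along with the equality of
    masses. *)
Lemma gauss_preim (E : set X) : measurable E ->
  measurable (B `&` T @^-1` E) /\ mu (B `&` T @^-1` E) = mu (B `&` E).
Proof.
have B0 : B (0 : K) by rewrite /B /= absv0.
have mB : measurable B by rewrite -(cball_unit B0); exact: measurable_cball.
rewrite {1}measurable_cballs; move: E.
apply: dynkin_induction; first exact: measurable_cballs.
- exact: cballs_setI.
- by rewrite preimage_setT setIT.
- move=> _ [->|[k [y ->]]]; first by rewrite preimage_set0 !setI0.
  have [By|nBy] := boolP (v y < 1).
    split; first exact: (gauss_preim_cball k By).1.
    rewrite mu_cball_unit// mu_preim_cball//.
    + by move=> x _; exact: gauss_map_unit.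
    + by move=> k' y' By'; exact: (gauss_preim_cball k' By').1.
    + by move=> k' y' By'; exact: (gauss_preim_cball k' By').2.
  (* A ball of radius at most 1 centred outside [B] misses [B], which contains the image of [T];
     both sides are empty. *)
  have dis : B `&` cball k y = set0.
    apply/seteqP; split=> // x [Bx Hx]; move/negP: nBy; apply.
    rewrite -(subKr x y); apply: ultraB_lt => //.
    exact: lt_le_trans Hx _.
  have -> : B `&` T @^-1` cball k y = set0.
    apply/seteqP; split=> // x [_ Tx]; have := gauss_map_unit x => BT.
    by have : (B `&` cball k y) (T x) by []; rewrite dis.
  by rewrite dis.
- move=> S mS [mTS muTS].
  have -> : B `&` T @^-1` (~` S) = B `\` (B `&` T @^-1` S).
    by rewrite preimage_setC setDIr setDv set0U.
  split; first exact: measurableD.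
  have -> : B `&` ~` S = B `\` S by [].
  (* Finite mass of [B] allows complements to be treated by subtraction. *)
  have muB : (mu B < +oo)%E by rewrite mu_unit ltry.
  by rewrite !measureD// setIA setIid; congr (_ - _)%E; exact: muTS.
- move=> S mS tS HS.
  rewrite preimage_bigcup !setI_bigcupr.
  have mT n : measurable (B `&` T @^-1` S n) := (HS n).1.
  split; first exact: bigcupT_measurable.
  rewrite !measure_semi_bigcup//.
  + by apply: eq_eseriesr => n _; exact: (HS n).2.
  + by move=> n; exact: measurableI.
  + exact: trivIset_setIl.
  + by apply: bigcupT_measurable => n; exact: measurableI.
  + by apply: trivIset_setIl => m n _ _ [x [Hm Hn]]; apply: tS => //; exists (T x).
  + exact: bigcupT_measurable.
Qed.

End BallMeasure.

Theorem lemma14 (R : realType) (p : nat) (Qp : fieldType) (vQ : Qp -> R)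
    (K : fieldExtType Qp) (v : K -> R) (e f : nat) (L : {subfield K})
    (gamma beta : K) (mu : {measure set (borel (valued v)) -> \bar R}) :
  prime p ->
  padic_completion p vQ ->
  absolute_value v ->
  (forall a : Qp, v a%:A = vQ a) ->
  ramification_index v fullv e ->
  residue_degree v f ->
  unramified v L ->
  \dim L = f ->
  (p ^ f - 1).-primitive_root gamma ->
  L = <<1; gamma>>%VS :> {vspace K} ->
  <<L; beta>>%VS = fullv ->
  v beta = p%:R `^ (e%:R^-1) ->
  haar_measure mu ->
  mu (unit_ball v) = 1%E ->
  measure_preserving (unit_ball v : set (borel (valued v))) mu
    (cf_map p vQ e f gamma beta).
Proof.
move=> p_prime compl av ext ram res _ _ prim _ _ vbeta [transl _ _] mu1.
have vn := ext_nat_le1 p_prime compl ext.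
have floorP := cf_floorP p_prime compl av ext ram res prim vbeta.
have digit1 c := residue_digits_le1 p_prime compl av ext prim (d := f) c.
(* Here [digit] becomes [residue_digits], [F] the set of [cf_floor_value], and [fl] becomes
   [cf_floor], which makes [gauss_map] the map [cf_map]. *)
have preim := gauss_preim av vn (absv_beta_gt1 p_prime av ram vbeta)
  (absv_betaZ p_prime compl av ext ram vbeta)
  (fun x H => etrans (esym (absv_lt_beta p_prime compl av ext ram vbeta x)) H)
  (@residue_digits_inj _ _ _ _ _ _ _ _ p_prime compl av ext prim)
  (@residue_digits_surj _ _ _ _ _ _ _ _ p_prime compl av ext res prim)
  digit1 (cf_floor_value_countable p e f gamma beta)
  (@cf_floor_value_eq _ _ _ _ _ _ _ _ _ _ p_prime compl av ext ram prim vbeta)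
  floorP transl mu1.
split=> [x _|_ E mE|E mE EB].
- exact: (gauss_map_unit av floorP).
- exact: (preim E mE).1.
- by rewrite [LHS](preim E mE).2 setIidr.
Qed.
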